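(* Let $S(\Sigma,Q,\eta)$ be a unital product entity and let $(\Sigma,\mathcal L,\xi)$ be the state property system it generates. The following are equivalent: (1) $\xi:\Sigma\to\mathcal P(\mathcal L)$ is injective; (2) the pre-order $<$ on $\Sigma$ is a partial order; (3) $\eta:\Sigma\to\mathcal P(Q)$ is injective; (4) $F(\Sigma,\mathcal L,\xi)=(\Sigma,\mathcal F)$ is a $T_0$ closure space.
   Context: All orders written $<$ are reflexive (non-strict). A state test entity $S(\Sigma,Q,\eta)$ consists of a set $\Sigma$ (states), a set $Q$ (tests) and a function $\eta:\Sigma\to\mathcal P(Q)$. On $Q$ define the pre-order $\alpha<\beta\Leftrightarrow$ (for all $p\in\Sigma$, $\alpha\in\eta(p)$ implies $\beta\in\eta(p)$). On $\Sigma$ define the pre-order $p<q\Leftrightarrow\eta(q)\subset\eta(p)$. A product test of a family $(\alpha_i)_i$ in $Q$ is a test $\Pi_i\alpha_i\in Q$ such that for all $p\in\Sigma$: $\Pi_i\alpha_i\in\eta(p)\Leftrightarrow\alpha_i\in\eta(p)$ for all $i$. A unit test is a $\tau\in Q$ with $\tau\in\eta(p)$ for all $p\in\Sigma$; a zero test is a $\delta\in Q$ with $\delta\notin\eta(p)$ for all $p\in\Sigma$. The entity is a unital product entity if $Q$ contains a unit test, a zero test, and a product test for each family in $Q$. Tests are equivalent, $\alpha\approx\beta$, if $\alpha<\beta$ and $\beta<\alpha$; $a(\alpha)$ denotes the equivalence class of $\alpha$. The state property system generated by $S(\Sigma,Q,\eta)$ is $(\Sigma,\mathcal L,\xi)$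 with $\Sigma$ pre-ordered by $p<q\Leftrightarrow\eta(q)\subset\eta(p)$, $\mathcal L=Q/_{\approx}=\{a(\alpha)\mid\alpha\in Q\}$ ordered by $a(\alpha)<a(\beta)\Leftrightarrow\alpha<\beta$ (a complete lattice), and $\xi(p)=\{a(\alpha)\mid\alpha\in\eta(p)\}$. $F(\Sigma,\mathcal L,\xi)=(\Sigma,\mathcal F)$ is the closure space with $\mathcal F=\{\kappa(a)\mid a\in\mathcal L\}$, $\kappa(a)=\{p\in\Sigma\mid a\in\xi(p)\}$. A closure space $(Z,\mathcal G)$ is a set $Z$ with $\mathcal G\subset\mathcal P(Z)$ containing $Z$ and $\emptyset$ and closed under arbitrary intersections; $cl(Y)=\bigcap\{G\in\mathcal G\mid Y\subset G\}$. It is $T_0$ if for all $x,y\in Z$, $cl(\{x\})=cl(\{y\})$ implies $x=y$. *)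

(* Defs.v *)
From mathcomp Require Import all_boot.
From mathcomp Require Import boolp classical_sets.
From Stdlib Require Relation_Definitions.

Set Implicit Arguments.
Unset Strict Implicit.
Unset Printing Implicit Defensive.

Local Open Scope classical_set_scope.

Record state_test_entity := StateTestEntity {
  state : Type;
  test : Type;
  eta : state -> set test }.

Section Entity.
Variable S : state_test_entity.
Implicit Types (p q : state S) (alpha beta : test S).

Definition test_le alpha beta := forall p, eta p alpha -> eta p beta.

(* Note the reversal: the larger state makes fewer tests certain. *)
Definition state_le p q := eta q `<=` eta p.

Definition is_product_test (I : Type) (alpha : I -> test S) (pi : test S) :=
  forall p, eta p pi <-> forall i, eta p (alpha i).

Definition is_unit_test (tau : test S) := forall p, eta p tau.

Definition is_zero_test (delta : test S) := forall p, ~ eta p delta.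

(* The index type is arbitrary, possibly empty. *)
Definition unital_product_entity :=
  [/\ exists tau, is_unit_test tau,
      exists delta, is_zero_test delta
    & forall (I : Type) (alpha : I -> test S),
        exists pi, is_product_test alpha pi].

Definition test_equiv alpha beta := test_le alpha beta /\ test_le beta alpha.

Definition test_class alpha : set (test S) := [set beta | test_equiv alpha beta].

(* The quotient of the tests by [test_equiv], as the type of all equivalence
   classes. *)
Definition property := set_type (range test_class).

(* The map alpha |-> a(alpha). *)
Definition property_of alpha : property :=
  exist _ (test_class alpha) (mem_set (imageT test_class alpha)).

(* Independent of the representatives by [property_leE] below. *)
Definition property_le (a b : property) :=
  exists alpha beta,
    [/\ a = property_of alpha, b = property_of beta & test_le alpha beta].

Definition xi p : set property := property_of @` eta p.

End Entity.

Section StatePropertyToClosure.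
Variables (Sigma L : Type) (x : Sigma -> set L).

Definition kappa (a : L) : set Sigma := [set p | x p a].

(* The family of closed sets of the closure space F(Sigma, L, x). *)
Definition closed_of : set (set Sigma) := range kappa.

End StatePropertyToClosure.

Section ClosureSpace.
Variables (Z : Type) (G : set (set Z)).

(* With [H := set0] the last clause repeats the first one. *)
Definition closure_space :=
  [/\ G setT, G set0
    & forall H : set (set Z), H `<=` G -> G (\bigcap_(A in H) A)].

(* [smallest G Y] is the intersection of the members of G containing Y. *)
Definition cl (Y : set Z) : set Z := smallest G Y.

Definition T0 := forall x y : Z, cl [set x] = cl [set y] -> x = y.

Definition T0_closure_space := closure_space /\ T0.

End ClosureSpace.

Definition complete_lattice (L : Type) (le : L -> L -> Prop) :=
  [/\ Relation_Definitions.order L le,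
      forall A : set L, exists m,
        forall b, le b m <-> (forall a, A a -> le b a)
    & forall A : set L, exists m,
        forall b, le m b <-> (forall a, A a -> le a b)].

Section EntityFacts.
Variable S : state_test_entity.
Implicit Types (alpha beta : test S).

Lemma property_of_eq alpha beta :
  property_of alpha = property_of beta <-> test_equiv alpha beta.
Proof.
split=> [/(congr1 val) /= E|[ab ba]].
  suff: test_class alpha beta by [].
  by rewrite E; split=> p.
apply: val_inj => /=; apply/seteqP; split=> g [h k]; split=> p.
- by move=> /ba /h.
- by move=> /k /ab.
- by move=> /ab /h.
- by move=> /k /ba.
Qed.

Lemma property_ofP (a : property S) : exists alpha, a = property_of alpha.
Proof.
case: a => A hA; have [alpha _ E] := set_mem hA.
by exists alpha; apply: val_inj => /=.
Qed.

Lemma property_leE alpha beta :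
  property_le (property_of alpha) (property_of beta) <-> test_le alpha beta.
Proof.
split=> [[g [h [/property_of_eq[a1 _] /property_of_eq[_ b2] gh]]] p|ab].
  by move=> /a1 /gh /b2.
by exists alpha, beta.
Qed.

Lemma property_complete_lattice :
  unital_product_entity S -> complete_lattice (@property_le S).
Proof.
move=> [_ _ prod].
have inf (A : set (property S)) : exists m,
    forall b, property_le b m <-> (forall a, A a -> property_le b a).
  have [pi hpi] := prod {alpha | A (property_of alpha)} sval.
  exists (property_of pi) => b; have [beta ->] := property_ofP b; split.
    move=> /property_leE h a; have [alpha ->] := property_ofP a => Aa.
    apply/property_leE => p /h /hpi h'; exact: (h' (exist _ alpha Aa)).
  move=> h; apply/property_leE => p bp; apply/hpi => -[alpha Aa] /=.
  by move: (h _ Aa) => /property_leE; apply.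
have ord : Relation_Definitions.order _ (@property_le S).
  split.
  - by move=> a; have [alpha ->] := property_ofP a; apply/property_leE => p.
  - move=> a b c; have [al ->] := property_ofP a.
    have [be ->] := property_ofP b; have [ga ->] := property_ofP c.
    by move=> /property_leE h /property_leE k; apply/property_leE => p /h /k.
  - move=> a b; have [al ->] := property_ofP a; have [be ->] := property_ofP b.
    by move=> /property_leE h /property_leE k; apply/property_of_eq.
split=> // A.
have [m hm] := inf [set u | forall a, A a -> property_le a u].
exists m => b; split=> [mb a Aa|h].
  apply: (Relation_Definitions.ord_trans _ _ ord _ m) => //.
  by apply/hm => u; apply.
have /hm : property_le m m by exact: (Relation_Definitions.ord_refl _ _ ord).
exact.
Qed.

End EntityFacts.

(* Main.v *)
Require Import Defs.
From mathcomp Require Import all_boot.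
From mathcomp Require Import boolp classical_sets.
From Stdlib Require Relation_Definitions.

(** The closed sets are the sets of states in which a given test is certain, so
    the closure of [{p}] is the set of states below [p]. Hence [xi p], [eta p],
    [cl {p}] and the equivalence class of [p] under the pre-order determine one
    another; products of tests give the intersections of closed sets. *)

Local Open Scope classical_set_scope.

(** Equivalent tests are certain in the same states, so passing to classes loses no information
    about [p]. *)
Lemma xi_property_of (S : state_test_entity) (p : state S) (alpha : test S) :
  xi p (property_of alpha) <-> eta p alpha.
Proof.
split=> [[beta pb /property_of_eq[ba _]]|pa]; first exact: ba.
by exists alpha.
Qed.

Lemma kappa_property_of (S : state_test_entity) (alpha : test S) :
  kappa (@xi S) (property_of alpha) = [set p | eta p alpha].
Proof. by apply/seteqP; split=> p /xi_property_of. Qed.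

Lemma closed_ofP (S : state_test_entity) (A : set (state S)) :
  closed_of (@xi S) A <-> exists alpha, A = [set p | eta p alpha].
Proof.
split=> [[a _ <-]|[alpha ->]].
  have [alpha ->] := property_ofP a.
  by exists alpha; rewrite kappa_property_of.
by exists (property_of alpha); rewrite ?kappa_property_of.
Qed.

Lemma xi_eq_eta (S : state_test_entity) (p q : state S) :
  xi p = xi q <-> eta p = eta q.
Proof.
split=> [E|E]; last by rewrite /xi E.
apply/seteqP; split=> alpha /xi_property_of pa; apply/xi_property_of.
  by rewrite -E.
by rewrite E.
Qed.

Lemma cl_state (S : state_test_entity) (p : state S) :
  cl (closed_of (@xi S)) [set p] = [set q | state_le q p].
Proof.
apply/seteqP; split=> q.
  (* Each test certain in [p] yields a closed set around [p], which must then contain [q]. *)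
  move=> h alpha pa; apply: (h [set r | eta r alpha]); split.
    by apply/closed_ofP; exists alpha.
  by move=> r ->.
move=> qp A [/closed_ofP[alpha ->] pA].
exact/qp/pA.
Qed.

Lemma cl_state_eq_eta (S : state_test_entity) (p q : state S) :
  cl (closed_of (@xi S)) [set p] = cl (closed_of (@xi S)) [set q] <->
  eta p = eta q.
Proof.
rewrite !cl_state; split=> [E|E]; last by rewrite /state_le E.
apply/seteqP; split.
  (* By reflexivity each state lies in its own down-set, hence in the other one. *)
  by have : [set r | state_le r p] q by rewrite E.
by have : [set r | state_le r q] p by rewrite -E.
Qed.

Lemma closed_of_closure_space (S : state_test_entity) :
  unital_product_entity S -> closure_space (closed_of (@xi S)).
Proof.
move=> [[tau ht] [delta hd] prod]; split.
- by apply/closed_ofP; exists tau; apply/seteqP; split=> p // _; apply: ht.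
- by apply/closed_ofP; exists delta; apply/seteqP; split=> p // /hd.
move=> H HG; apply/closed_ofP.
(* Indexing by every test that represents a member of [H] avoids choosing representatives; for empty
   [H] the product is certain everywhere. *)
have [pi hpi] := prod {alpha | H [set p | eta p alpha]} sval.
exists pi; apply/seteqP; split=> p.
  by move=> Hp; apply/hpi => -[alpha Ha]; apply: (Hp _ Ha).
move=> /hpi pa A HA; have /closed_ofP[alpha EA] := HG _ HA.
by move: HA; rewrite EA => HA; apply: (pa (exist _ alpha HA)).
Qed.

Theorem proposition14 (S : state_test_entity) (hS : unital_product_entity S) :
  [<-> injective (@xi S);
       Relation_Definitions.order (state S) (@state_le S);
       injective (@eta S);
       T0_closure_space (closed_of (@xi S))].
Proof.
tfae.
- move=> xi_inj; split=> [p|p q r pq qr|p q pq qp] //.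
    exact: subset_trans qr pq.
  (* [pq] and [qp] are the two inclusions between [eta p] and [eta q]. *)
  by apply/xi_inj/xi_eq_eta/seteqP.
- by move=> [_ _ anti] p q E; apply: anti; rewrite /state_le E.
- move=> eta_inj; split; first exact: closed_of_closure_space.
  by move=> p q /cl_state_eq_eta; apply: eta_inj.
- by move=> [_ t0] p q /xi_eq_eta E; apply/t0/cl_state_eq_eta.
Qed.
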